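(* Let $l=7$, $r\in\{1,2,3\}$, $a=[r]$, $b=[4r]$, $c=[2r]$. Then $p_{8,0}(1/a)=b^8c^8$ and $p_{8,2}(1/a)=(a^2+b^8)c^8$.
   Context: For an integer $i$, $[i]=\sum x^{n^2}\in\mathbb{Z}/2[[x]]$, summed over $n\in\mathbb{Z}$ with $n\equiv i\pmod 7$. $1/a$ is taken in the field $L$ of Laurent series over $\mathbb{Z}/2$. For $q$ a power of $2$ and $0\le j<q$, $p_{q,j}:L\to L$ is $\sum_n c_nx^n\mapsto\sum_{n\equiv j\pmod q}c_nx^n$. *)

(* Defs.v *)
From HB Require Import structures.
From mathcomp Require Import all_boot all_order all_algebra.
From mathcomp Require Import zify ring.
From mathcomp Require Import boolp classical_sets functions cardinality fsbigop.

Set Implicit Arguments.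
Unset Strict Implicit.
Unset Printing Implicit Defensive.

Import Order.TTheory GRing.Theory Num.Theory.

Local Open Scope ring_scope.

Record laurent (K : fieldType) := Laurent {
  lcoef :> int -> K;
  lcoef_bounded : exists N : int, forall n : int, n < N -> lcoef n = 0
}.

HB.instance Definition _ (K : fieldType) := gen_eqMixin (laurent K).
HB.instance Definition _ (K : fieldType) := gen_choiceMixin (laurent K).

Section LaurentField.
Variable K : fieldType.
Implicit Types (f g h : laurent K) (n M N P : int).

Lemma laurentP f g : (forall n, f n = g n) -> f = g.
Proof.
case: f => f Hf; case: g => g Hg /= /funext fg; subst g.
by rewrite (Prop_irrelevance Hf Hg).
Qed.

Fact lzero_bounded : exists N, forall n, n < N -> (fun=> 0 : K) n = 0.
Proof. by exists 0. Qed.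
Definition lzero := Laurent lzero_bounded.

Fact lone_bounded :
  exists N, forall n, n < N -> (fun n => (n == 0)%:R : K) n = 0.
Proof. by exists 0 => n n0; rewrite lt_eqF. Qed.
Definition lone := Laurent lone_bounded.

Fact lopp_bounded f : exists N, forall n, n < N -> - f n = 0.
Proof. by have [N fN] := lcoef_bounded f; exists N => n /fN ->; rewrite oppr0. Qed.
Definition lopp f := Laurent (lopp_bounded f).

Lemma common_bound f g :
  exists N, (forall n, n < N -> f n = 0) /\ (forall n, n < N -> g n = 0).
Proof.
have [M fM] := lcoef_bounded f; have [N gN] := lcoef_bounded g.
by exists (Num.min M N); split=> n; rewrite lt_min => /andP[? ?]; auto.
Qed.

Fact ladd_bounded f g : exists N, forall n, n < N -> f n + g n = 0.
Proof.
have [N [fN gN]] := common_bound f g.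
by exists N => n nN; rewrite fN ?gN ?addr0.
Qed.
Definition ladd f g := Laurent (ladd_bounded f g).

(* \sum_(i \in A) is 0 by convention on infinite supports; for f and g bounded
   below the support is finite, see conv_nat. *)
Definition conv (f g : int -> K) n : K := \sum_(i \in [set: int]) f i * g (n - i).

Lemma conv_nat (f g : int -> K) M N (B : nat) n :
  (forall i, i < M -> f i = 0) -> (forall i, i < N -> g i = 0) ->
  n - M - N < B%:Z ->
  conv f g n = \sum_(k < B) f (M + k%:Z) * g (n - (M + k%:Z)).
Proof.
move=> fM gN nB.
pose s := [seq M + k%:Z | k <- index_iota 0 B].
have us : uniq s by rewrite map_inj_uniq ?iota_uniq// => x y /addrI[].
rewrite /conv -(fsbig_widen [set` s] setT) //.
  rewrite -fsbig_seq// big_map.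
  by rewrite big_mkord.
move=> i /= [_ iNs].
have [/fM -> | iM] := ltP i M; first by rewrite mul0r.
have [/gN -> | niN] := ltP (n - i) N; first by rewrite mulr0.
case: iNs; apply/mapP; exists `|i - M|%N; last lia.
by rewrite mem_index_iota; lia.
Qed.

Fact lmul_bounded f g : exists N, forall n, n < N -> conv f g n = 0.
Proof.
have [M fM] := lcoef_bounded f; have [N gN] := lcoef_bounded g.
exists (M + N) => n nMN.
by rewrite (conv_nat (B := 0) fM gN) ?big_ord0//; lia.
Qed.
Definition lmul f g := Laurent (lmul_bounded f g).

Definition linv f : laurent K := xget lzero [set g | lmul g f = lone].

Definition ltrunc (B : nat) N f : {poly K} := \poly_(k < B) f (N + k%:Z).

Lemma coef_ltrunc B N f k : (k < B)%N -> (ltrunc B N f)`_k = f (N + k%:Z).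
Proof. by rewrite coef_poly => ->. Qed.

Lemma lmul_trunc f g M N (B k : nat) :
  (forall i, i < M -> f i = 0) -> (forall i, i < N -> g i = 0) ->
  (k < B)%N ->
  lmul f g (M + N + k%:Z) = (ltrunc B M f * ltrunc B N g)`_k.
Proof.
move=> fM gN kB; rewrite /= (conv_nat (B := k.+1) fM gN); last lia.
rewrite coefM; apply: eq_bigr => -[i ik] _ /=.
rewrite !coef_ltrunc; [|lia|lia].
by congr (_ * g _); lia.
Qed.

Lemma lmul_low f g M N n :
  (forall i, i < M -> f i = 0) -> (forall i, i < N -> g i = 0) ->
  n < M + N -> lmul f g n = 0.
Proof.
by move=> fM gN nMN; rewrite /= (conv_nat (B := 0) fM gN) ?big_ord0//; lia.
Qed.

Lemma laurentP_from N f g :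
  (forall n, n < N -> f n = 0) -> (forall n, n < N -> g n = 0) ->
  (forall k : nat, f (N + k%:Z) = g (N + k%:Z)) -> f = g.
Proof.
move=> fN gN fg; apply: laurentP => n.
have [nN|Nn] := ltP n N; first by rewrite fN ?gN.
by have -> : n = N + `|n - N|%N%:Z by lia.
Qed.

Lemma lmulC : commutative lmul.
Proof.
move=> f g; have [M fM] := lcoef_bounded f; have [N gN] := lcoef_bounded g.
apply: (@laurentP_from (M + N)) => [n|n|k]; first exact: lmul_low.
  by rewrite addrC; exact: lmul_low.
rewrite (lmul_trunc fM gN (ltnSn k)) mulrC.
by rewrite -(lmul_trunc gN fM (ltnSn k)) [M + N]addrC.
Qed.

Lemma lmulA : associative lmul.
Proof.
move=> f g h; have [M fM] := lcoef_bounded f.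
have [N gN] := lcoef_bounded g; have [P hP] := lcoef_bounded h.
have fgMN n : n < M + N -> lmul f g n = 0 by exact: lmul_low.
have ghNP n : n < N + P -> lmul g h n = 0 by exact: lmul_low.
apply: (@laurentP_from (M + N + P)) => [n||k].
- by rewrite -addrA; exact: lmul_low.
- by move=> n; exact: lmul_low.
rewrite (lmul_trunc fgMN hP (ltnSn k)) -[M + N + P]addrA.
rewrite (lmul_trunc fM ghNP (ltnSn k)).
transitivity ((ltrunc k.+1 M f * ltrunc k.+1 N g * ltrunc k.+1 P h)`_k).
  rewrite -mulrA !coefM; apply: eq_bigr => -[i ik] _ /=; congr (_ * _).
  by rewrite coef_ltrunc 1?(lmul_trunc gN hP (B := k.+1))//; lia.
rewrite coefM [RHS]coefM; apply: eq_bigr => -[i ik] _ /=; congr (_ * _).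
by rewrite coef_ltrunc 1?(lmul_trunc fM gN (B := k.+1))//; lia.
Qed.

Lemma lmul1 : left_id lone lmul.
Proof.
move=> f; have [N fN] := lcoef_bounded f.
have l0 n : n < 0 -> lone n = 0 by move=> n0 /=; rewrite lt_eqF.
apply: laurentP => n; rewrite /=.
rewrite (conv_nat (B := `|n - N|.+1) l0 fN); last lia.
rewrite big_ord_recl /= mul1r add0r subr0 big1 ?addr0// => i _.
by rewrite /= mul0r.
Qed.

Lemma lmulDl : left_distributive lmul ladd.
Proof.
move=> f g h; have [M [fM gM]] := common_bound f g.
have [N hN] := lcoef_bounded h.
have fgM n : n < M -> ladd f g n = 0 by move=> nM /=; rewrite fM ?gM ?addr0.
apply: laurentP => n /=; have nB : n - M - N < (absz (n - M - N)%R).+1%:Z by lia.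
rewrite (conv_nat fgM hN nB) (conv_nat fM hN nB) (conv_nat gM hN nB).
by rewrite -big_split; apply: eq_bigr => i _ /=; rewrite mulrDl.
Qed.

Lemma laddA : associative ladd.
Proof. by move=> f g h; apply: laurentP => n /=; rewrite addrA. Qed.
Lemma laddC : commutative ladd.
Proof. by move=> f g; apply: laurentP => n /=; rewrite addrC. Qed.
Lemma ladd0 : left_id lzero ladd.
Proof. by move=> f; apply: laurentP => n /=; rewrite add0r. Qed.
Lemma laddN : left_inverse lzero lopp ladd.
Proof. by move=> f; apply: laurentP => n /=; rewrite addNr. Qed.

HB.instance Definition _ :=
  GRing.isZmodule.Build (laurent K) laddA laddC ladd0 laddN.

Fact lone_neq0 : lone != 0 :> laurent K.
Proof.
by apply/eqP => /(congr1 (fun f : laurent K => f 0)) /eqP; rewrite /= oner_eq0.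
Qed.

HB.instance Definition _ := GRing.Zmodule_isComNzRing.Build (laurent K)
  lmulA lmulC lmul1 lmulDl lone_neq0.

Lemma valuation_ex f : f != 0 ->
  exists v, f v != 0 /\ forall n, n < v -> f n = 0.
Proof.
move=> f0; have [N fN] := lcoef_bounded f.
have ex : exists k : nat, f (N + k%:Z) != 0.
  apply: contrapT => /forallNP fk; move/eqP: f0; apply.
  by apply: (laurentP_from fN) => // k; apply/eqP; rewrite -[_ == _]negbK; apply/negP.
case: (ex_minnP ex) => v fv vmin; exists (N + v%:Z); split=> // n nv.
have [/fN //|Nn] := ltP n N; apply/eqP; rewrite -[_ == _]negbK; apply/negP.
have -> : n = N + `|n - N|%N%:Z by lia.
by move/vmin; lia.
Qed.

Fixpoint inv_seq (u : nat -> K) (n : nat) : seq K :=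
  if n is m.+1 then
    let s := inv_seq u m in
    rcons s ((u 0)^-1 * ((m == 0)%:R - \sum_(i < m) s`_i * u (m - i)%N))
  else [::].

Lemma size_inv_seq u (n : nat) : size (inv_seq u n) = n.
Proof. by elim: n => //= n IH; rewrite size_rcons IH. Qed.

Lemma nth_inv_seq u (n m : nat) : (m < n)%N -> (inv_seq u n)`_m = (inv_seq u m.+1)`_m.
Proof.
elim: n => // n IH; rewrite ltnS leq_eqVlt => /predU1P[-> //|mn].
by rewrite {1}/inv_seq -/inv_seq nth_rcons size_inv_seq mn IH.
Qed.

Lemma inv_seqP u (n : nat) : u 0%N != 0 ->
  \sum_(i < n.+1) (inv_seq u i.+1)`_i * u (n - i)%N = (n == 0)%:R.
Proof.
move=> u0; rewrite big_ord_recr /= nth_rcons size_inv_seq ltnn eqxx subnn.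
rewrite mulrC mulVKf// addrC -[RHS]addr0 -addrA; congr (_ + _).
apply/eqP; rewrite addrC subr_eq0; apply/eqP; apply: eq_bigr => i _.
by rewrite [in RHS]nth_inv_seq.
Qed.

Lemma linv_ex f : f != 0 -> exists g : laurent K, lmul g f = lone.
Proof.
move=> /valuation_ex[v [fv flow]].
pose u (k : nat) := f (v + k%:Z).
have u0 : u 0%N != 0 by rewrite /u addr0.
pose w n := if n < - v then 0 else (inv_seq u (absz (n + v)%R).+1)`_(absz (n + v)%R).
have wlow n : n < - v -> w n = 0 by rewrite /w => ->.
have wb : exists N, forall n, n < N -> w n = 0 by exists (- v).
have lone0 n : n < 0 -> lone n = 0 by move=> n0 /=; rewrite lt_eqF.
exists (Laurent wb); apply: (@laurentP_from 0) => // [n n0|k].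
  by apply: (@lmul_low (Laurent wb) f _ _ _ wlow flow); lia.
rewrite add0r /= (conv_nat (B := k.+1) wlow flow); last lia.
rewrite -[RHS](inv_seqP k u0); apply: eq_bigr => -[i ik] _ /=.
rewrite /w ltNge lerDl le0z_nat /=.
by rewrite addrAC addNr add0r /u; congr (_ * f _); lia.
Qed.

Fact lmulVf f : f != 0 -> linv f * f = 1.
Proof. by move=> /linv_ex[g gf]; apply: (xgetPex lzero (P := [set g | lmul g f = lone])); exists g. Qed.

Fact linv0 : linv 0 = 0.
Proof.
rewrite /linv; case: xgetP => // g _ /= /eqP.
by rewrite -[lmul g 0]/(g * 0 : laurent K) mulr0 eq_sym (negPf lone_neq0).
Qed.

HB.instance Definition _ :=
  GRing.ComNzRing_isField.Build (laurent K) lmulVf linv0.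

Fact lproj_bounded (q : nat) (j : int) f :
  exists N, forall n, n < N -> (if (n == j %[mod q])%Z then f n else 0) = 0.
Proof. by have [N fN] := lcoef_bounded f; exists N => n /fN ->; case: ifP. Qed.

Definition lproj (q : nat) (j : int) f : laurent K :=
  Laurent (lproj_bounded q j f).

End LaurentField.

(* theta l i is the sum of x^(k^2) over all integers k congruent to i mod l; its
   n-th coefficient counts mod 2 the (finitely many) such k with k^2 = n. *)
Definition theta_coef (l : nat) (i n : int) : 'F_2 :=
  \sum_(k \in [set k : int | (k = i %[mod l])%Z /\ k ^+ 2 = n]) (1 : 'F_2).

Fact theta_bounded (l : nat) (i : int) :
  exists N : int, forall n : int, n < N -> theta_coef l i n = 0.
Proof.
exists 0 => n n0; rewrite /theta_coef.
suff -> : [set k : int | (k = i %[mod l])%Z /\ k ^+ 2 = n]%classic = set0%classic.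
  by rewrite fsbig_set0.
apply/seteqP; split=> k //= [_ kn].
by move: n0; rewrite -kn ltNge sqr_ge0.
Qed.

Definition theta (l : nat) (i : int) : laurent 'F_2 :=
  Laurent (theta_bounded l i).

(* Main.v *)
Require Import Defs.
From mathcomp Require Import all_boot all_order all_algebra.
From mathcomp Require Import zify ring.
From mathcomp Require Import boolp classical_sets functions cardinality fsbigop.

(* Write [A = a - b^4] and [B = b - c^4]: since squares of even integers are 4 times
   squares and odd squares are 1 mod 8, these are the parts of [a] and [b]
   coming from odd integers, and they live in degrees 1 mod 8.
   The bijection (u, v) |-> (u + v, u - v), under which the sum of squares doubles,
   shows that the even part of [a b] is [(a c)^2], i.e. b^4 c^4 + A B = a^2 c^2.
   Because [a^8] is a series in x^8, the projections of 1/a are those of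
   a^7 = a * a^2 * a^4 divided by a^8; expanding
   (c^16 + B^4 + A) (b^8 + A^2) (b^16 + A^4), the terms in degrees 0 mod 8 sum to
   b^8 (b^4 c^4 + A B)^4 and those in degrees 2 mod 8 to A^2 (b^4 c^4 + A B)^4. *)

Set Implicit Arguments.
Unset Strict Implicit.
Unset Printing Implicit Defensive.

Import Order.TTheory GRing.Theory Num.Theory.
Local Open Scope ring_scope.

(** * Squaring of polynomials in characteristic 2 *)

Lemma coef_sqr_pchar2 (K : fieldType) (p : {poly K}) (k : nat) :
  2%N \in [pchar K] ->
  (p ^+ 2)`_k = if odd k then 0 else p`_(k./2) ^+ 2.
Proof.
move=> K2; elim/poly_ind: p k => [|p c IH] k.
  by rewrite expr0n !coef0 expr0n if_same.
have P2 : 2%N \in [pchar {poly K}] by rewrite pchar_poly.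
have -> : (p * 'X + c%:P) ^+ 2 = p ^+ 2 * 'X^2 + (c ^+ 2)%:P.
  by rewrite exprDn_pchar ?pnatE// exprMn -polyC_exp.
rewrite coefD coefMXn coefC coefD coefC coefMX.
case: k => [|[|k]] /=; rewrite ?add0r ?addr0//.
by rewrite subn2 /= IH negbK.
Qed.

(** * Congruences, and series supported in a single residue class of degrees *)

Lemma eq_modD (q m m' n n' : int) :
  (m = m' %[mod q])%Z -> (n = n' %[mod q])%Z -> (m + n = m' + n' %[mod q])%Z.
Proof. by move=> mm nn; rewrite -[LHS]modzDm mm nn modzDm. Qed.

Lemma eq_modN (q m n : int) : (m = n %[mod q])%Z -> (- m = - n %[mod q])%Z.
Proof. by move=> mn; rewrite -[LHS]modzNm mn modzNm. Qed.

Definition graded {K : fieldType} (q : nat) (j : int) (f : laurent K) :=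
  forall n : int, f n != 0 -> (n = j %[mod q])%Z.

Section Graded.
Variable K : fieldType.
Implicit Types (f g : laurent K) (i j n : int) (q : nat).

Lemma graded_mul q i j f g :
  graded q i f -> graded q j g -> graded q (i + j) (f * g).
Proof.
move=> fi gj n; apply: contra_neqP => nij.
rewrite [LHS]fsbig1// => m _; apply/eqP; rewrite mulf_eq0.
apply: contra_notT nij; rewrite negb_or => /andP[/fi mi /gj nmj].
by rewrite -[n](subrKC m); exact: eq_modD.
Qed.

Lemma graded_exp q j f k : graded q j f -> graded q (j *+ k) (f ^+ k).
Proof.
move=> fj; elim: k => [|k IH].
  by move=> n; have [-> //|n0] := eqVneq n 0; rewrite /= (negPf n0) eqxx.
by rewrite exprS mulrS; apply: graded_mul.
Qed.

Lemma graded_dvd q q' j f : (q %| q')%N -> graded q' j f -> graded q j f.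
Proof.
move=> qq' fj n /fj /eqP; rewrite eqz_mod_dvd => nj.
by apply/eqP; rewrite eqz_mod_dvd; apply: dvdz_trans nj.
Qed.

Lemma lprojD q j f g : lproj q j (f + g) = lproj q j f + lproj q j g.
Proof. by apply: laurentP => n /=; case: ifP => // _; rewrite addr0. Qed.

Lemma lproj_graded q i j f : graded q i f ->
  lproj q j f = if (i == j %[mod q])%Z then f else 0.
Proof.
move=> fi; apply: laurentP => n /=.
have [fn0|/fi ni] := eqVneq (f n) 0; first by rewrite fn0 if_same; case: ifP.
by rewrite ni; case: ifP.
Qed.

(** Multiplying by a series in [x^q] does not move residue classes mod [q]. This is what allows the
    denominator [a ^+ 8] to be cleared under a projection. *)
Lemma lproj_mulr q j f g : graded q 0 g -> lproj q j (f * g) = lproj q j f * g.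
Proof.
move=> g0; apply: laurentP => n /=.
transitivity (\sum_(i \in [set: int]) (if (n == j %[mod q])%Z then f i * g (n - i) else 0)).
  by case: ifP => // _; rewrite fsbig1.
apply: eq_fsbigr => i _ /=.
have [->|/g0 ni0] := eqVneq (g (n - i)) 0; first by rewrite !mulr0 if_same.
have -> : (n = i %[mod q])%Z.
  by rewrite -[in LHS](subrKC i n) -[i in RHS]addr0; exact: eq_modD.
by case: ifP => // _; rewrite mul0r.
Qed.

End Graded.

(** * The Frobenius map on Laurent series in characteristic 2 *)

Section Frobenius.
Variable K : fieldType.
Hypothesis K2 : 2%N \in [pchar K].
Implicit Types (f : laurent K) (n : int).

Lemma pchar_laurent : 2%N \in [pchar laurent K].
Proof.
apply/andP; split=> //; apply/eqP; apply: laurentP => n /=.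
by rewrite -mulr2n (mulrn_pchar K2).
Qed.

(** Each coefficient of a product depends only on truncations of the factors, so the polynomial case
    applies. *)
Lemma sqr_coef f n :
  (f ^+ 2) n = if (2 %| n)%Z then f (n %/ 2)%Z ^+ 2 else 0.
Proof.
have [M0 fM0] := lcoef_bounded f.
pose M : int := - `|M0|%:Z; have fM i : (i < M)%R -> f i = 0 by move=> iM; apply: fM0; lia.
have [nM|Mn] := ltP n (M + M).
  by rewrite expr2 [LHS](lmul_low fM fM nM) fM ?expr0n ?if_same//; lia.
pose k := absz (n - (M + M))%R.
have -> : n = M + M + k%:Z by lia.
rewrite [LHS](lmul_trunc fM fM (ltnSn k)) -expr2 coef_sqr_pchar2//.
have -> : (2 %| M + M + k%:Z)%Z = ~~ odd k by lia.
case: (boolP (odd k)) => //= k2.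
by rewrite coef_ltrunc; [congr (f _ ^+ 2)|]; lia.
Qed.

Lemma expr4_coef f n :
  (f ^+ 4) n = if (4 %| n)%Z then f (n %/ 4)%Z ^+ 4 else 0.
Proof.
have -> : f ^+ 4 = f ^+ 2 ^+ 2 by rewrite -exprM.
rewrite !sqr_coef.
case: (boolP (2 %| n)%Z) => n2; last by (rewrite ifN; [by []|lia]).
have -> : (2 %| n %/ 2)%Z = (4 %| n)%Z by lia.
by case: ifP => n4; rewrite ?expr0n// -exprM; congr (f _ ^+ 4); lia.
Qed.

Lemma graded_expr4 f : graded 4 0 (f ^+ 4).
Proof.
by move=> n; rewrite expr4_coef; case: ifP => [n4 _|]; [lia|rewrite eqxx].
Qed.

Lemma graded_expr8 f : graded 8 0 (f ^+ 8).
Proof.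
move=> n; have -> : f ^+ 8 = (f ^+ 4) ^+ 2 by rewrite -exprM.
rewrite sqr_coef; case: ifP => [n2|]; last by rewrite eqxx.
by rewrite expf_eq0 /= => /graded_expr4; lia.
Qed.

End Frobenius.

(** * Powers in ['F_2] and residues of integer squares *)

Lemma F2_pchar : 2%N \in [pchar 'F_2].
Proof. exact: pchar_Fp. Qed.

Lemma F2_exp (x : 'F_2) k : x ^+ k.+1 = x.
Proof.
have [->|->] : x = 0 \/ x = 1; last 2 first.
- by rewrite exprS mul0r.
- by rewrite expr1n.
by case: x => [[|[|//]] ?]; [left|right]; apply: val_inj.
Qed.

Lemma sqr_mod8 (k : int) : exists w : int, k ^+ 2 = w * 8 + (k %% 4)%Z ^+ 2.
Proof.
exists ((k %/ 4)%Z ^+ 2 *+ 2 + (k %/ 4)%Z * (k %% 4)%Z).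
by rewrite {1}(divz_eq k 4); ring.
Qed.

(** Parity of a square in linear form: [lia] can use it with [k ^+ 2] as an atom. *)
Lemma sqr_mod2 (k : int) : exists w : int, k ^+ 2 = w * 2 + k.
Proof.
have [w ->] := sqr_mod8 k.
have : (k %% 4 = 0 \/ k %% 4 = 1 \/ k %% 4 = 2 \/ k %% 4 = 3)%Z by lia.
case=> [|[|[|]]] kd; rewrite kd; set q := (k %/ 4)%Z.
- by exists (w * 4 - q * 2); rewrite /q; lia.
- by exists (w * 4 - q * 2); rewrite /q; lia.
- by exists (w * 4 - q * 2 + 1); rewrite /q; lia.
by exists (w * 4 - q * 2 + 3); rewrite /q; lia.
Qed.

(** * Theta series: parity dissection and products *)

Section Theta.
Variable l : nat.
Implicit Types (i j k m n s t x : int).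

Lemma eq_theta i j : (i = j %[mod l])%Z -> theta l i = theta l j.
Proof. by move=> ij; apply: laurentP => n; rewrite /= /theta_coef ij. Qed.

Lemma thetaN i : theta l (- i) = theta l i.
Proof.
apply: laurentP => n /=; rewrite /theta_coef.
apply: (reindex_fsbig -%R); split=> [k [/eq_modN ki kn]|k k' _ _ /oppr_inj//|k].
  by rewrite /= sqrrN.
move=> [/eq_modN]; rewrite opprK => ki kn.
by exists (- k); rewrite /= ?sqrrN ?opprK.
Qed.

(** Only [i] and [- i] have square [i ^+ 2], and [- i] lies in another class mod [l], so the
    coefficient at [i ^+ 2] is 1. *)
Lemma theta_neq0 i : ~~ (l %| i *+ 2)%Z -> theta l i != 0.
Proof.
move=> li; apply/eqP => /(congr1 (fun f : laurent 'F_2 => f (i ^+ 2))) /=.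
rewrite /theta_coef (_ : [set k | _]%classic = [set i]%classic) ?fsbig_set1//.
apply/seteqP; split=> [k /= [ki /eqP]|k /= -> //].
rewrite eqf_sqr => /orP[/eqP //|/eqP kN]; case/negP: li.
by rewrite mulr2n -[X in X + _]opprK -kN addrC -eqz_mod_dvd ki.
Qed.

(** A finite index set independent of [x] makes it possible to exchange this sum with a sum over
    [x]. *)
Lemma theta_coef_bounded (W : set int) i x : finite_set W ->
  (forall k, k ^+ 2 = x -> W k) ->
  theta_coef l i x = \sum_(k \in W) (((k == i %[mod l])%Z && (k ^+ 2 == x))%:R : 'F_2).
Proof.
move=> finW xW.
transitivity (\sum_(k \in [set k | (k = i %[mod l])%Z /\ k ^+ 2 = x]%classic)
   (((k == i %[mod l])%Z && (k ^+ 2 == x))%:R : 'F_2)).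
  by apply: eq_fsbigr => k; rewrite inE /= => -[-> ->]; rewrite !eqxx.
apply: fsbig_widen => [k [_ /xW]//|k /= [_ kx]].
by case: andP => // -[/eqP ? /eqP ?]; case: kx.
Qed.

Definition theta_pairs i j n : set (int * int) := [set p |
  [/\ (p.1 = i %[mod l])%Z, (p.2 = j %[mod l])%Z & p.1 ^+ 2 + p.2 ^+ 2 = n]]%classic.

Lemma finite_int_itv (n : int) : finite_set [set x : int | - n <= x <= n]%classic.
Proof.
apply: (@sub_finite_set _ _ [set` [seq y%:Z - n | y <- iota 0 (`|n| * 2).+1]]%classic) => //.
move=> x xn; have {}xn : - n <= x <= n := xn.
apply/mapP; exists (absz (x + n)%R); last lia.
by rewrite mem_iota; lia.
Qed.

Lemma theta_mul_coef i j n :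
  (theta l i * theta l j) n = \sum_(p \in theta_pairs i j n) (1 : 'F_2).
Proof.
pose W : set int := [set x | - n <= x <= n]%classic.
have finW : finite_set W by exact: finite_int_itv.
have sqr_le (k x : int) : k ^+ 2 = x -> x <= n -> - n <= k <= n.
  by rewrite expr2 => <-; have [k0|k0] := leP 0 k; nia.
pose V : set int := [set x | 0 <= x <= n]%classic.
have finV : finite_set V by apply: sub_finite_set finW => x; rewrite /V /W /=; lia.
have theta_lt0 i' x : x < 0 -> theta_coef l i' x = 0.
  move=> x0; rewrite (@theta_coef_bounded set0)// ?fsbig_set0// => k kx.
  by move: x0; rewrite -kx ltNge sqr_ge0.
pose F i k x : 'F_2 := ((k == i %[mod l])%Z && (k ^+ 2 == x))%:R.
transitivity (\sum_(x \in V) theta_coef l i x * theta_coef l j (n - x)).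
  apply/esym/fsbig_widen => // x /= [_ /negP]; rewrite negb_and -!ltNge.
  case/orP=> x0; first by rewrite theta_lt0 ?mul0r.
  by rewrite (theta_lt0 j) ?mulr0// subr_lt0.
transitivity (\sum_(x \in V) \sum_(k \in W) \sum_(m \in W) F i k x * F j m (n - x)).
  apply: eq_fsbigr => x; rewrite inE /V /= => xV.
  rewrite (@theta_coef_bounded W i)//; last by move=> k /sqr_le; apply; lia.
  rewrite (@theta_coef_bounded W j)//; last by move=> k /sqr_le; apply; lia.
  by rewrite mulr_fsuml; apply: eq_fsbigr => k _; rewrite mulr_fsumr.
rewrite exchange_fsbig//.
(* With the sum over [x] innermost, a pair [(k, m)] contributes only through [x = k ^+ 2], and only
   if [n - x = m ^+ 2]. *)
transitivity (\sum_(k \in W) \sum_(m \in W) \sum_(x \in V) F i k x * F j m (n - x)).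
  by apply: eq_fsbigr => k _; rewrite exchange_fsbig.
rewrite pair_fsbig//.
transitivity (\sum_(p \in W `*` W) \sum_(x \in V) F i p.1 x * F j p.2 (n - x)).
  by [].
transitivity (\sum_(p \in theta_pairs i j n) \sum_(x \in V) F i p.1 x * F j p.2 (n - x)).
  apply/esym/fsbig_widen => [[k m] [/= _ _ kmn]|[k m] /= [_ kmn]].
    by split; rewrite /W /=; nia.
  rewrite fsbig1// => x _; rewrite /F -natrM mulnb.
  case: andP => // -[/andP[/eqP ki /eqP kx] /andP[/eqP mj /eqP mx]].
  by case: kmn; split=> //=; rewrite kx mx subrKC.
apply: eq_fsbigr => -[k m]; rewrite inE => -[/= ki mj kmn].
rewrite -(@fsbig_widen _ _ _ _ [set k ^+ 2]%classic).
- by rewrite fsbig_set1 /F ki mj -kmn addrC addKr !eqxx mulr1.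
- by move=> _ ->; rewrite /V /= -kmn lerDl !sqr_ge0.
by move=> x /= [_ /eqP]; rewrite /F eq_sym => /negPf ->; rewrite andbF mul0r.
Qed.

Hypothesis l_odd : odd l.

Lemma eq_mod_double i j : (i *+ 2 = j *+ 2 %[mod l])%Z -> (i = j %[mod l])%Z.
Proof.
move=> /eqP; rewrite eqz_mod_dvd -mulrnBl -mulr_natr Gauss_dvdzl.
  by rewrite -eqz_mod_dvd => /eqP.
by rewrite coprimezE /= coprimen2.
Qed.

(** Even [k = 2m] in the class of [i] are those with [m] in the class of [j]; they contribute
    [x^(4m^2)], which is [theta l j ^+ 4] by Frobenius. Odd squares are 1 mod 8. *)
Lemma theta_odd_part i j : (j *+ 2 = i %[mod l])%Z ->
  graded 8 1 (theta l i - theta l j ^+ 4).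
Proof.
move=> ji n; apply: contra_neqP => n1.
have -> : (theta l i - theta l j ^+ 4) n = theta_coef l i n - (theta l j ^+ 4) n by [].
rewrite expr4_coef ?F2_pchar// F2_exp.
case: ifP => n4; last first.
  rewrite subr0 /theta_coef fsbig1// => k [_ kn].
  have [w] := sqr_mod8 k; rewrite kn => nw.
  have : (k %% 4 = 0 \/ k %% 4 = 1 \/ k %% 4 = 2 \/ k %% 4 = 3)%Z by lia.
  by case=> [|[|[|]]] kd; move: nw; rewrite kd; lia.
apply/eqP; rewrite subr_eq0; apply/eqP; rewrite /= /theta_coef.
apply: (reindex_fsbig (fun k => k *+ 2)); split.
- move=> k /= [kj kn]; split.
    by rewrite -ji !mulr2n; exact: eq_modD.
  have -> : (k *+ 2) ^+ 2 = k ^+ 2 * 4 by ring.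
  by rewrite kn; move: n4; clear; lia.
- by move=> k k' _ _; lia.
move=> k /= [ki kn].
have k2 : k = (k %/ 2)%Z *+ 2 by have [w] := sqr_mod2 k; move: kn n4; clear; lia.
exists (k %/ 2)%Z => //; split.
  by apply: eq_mod_double; rewrite -k2 ki ji.
have : k ^+ 2 = (k %/ 2)%Z ^+ 2 * 4 by rewrite {1}k2; ring.
by rewrite kn; move: n4; clear; lia.
Qed.

(** For even [n], the pairs counted on the left are the [(u + v, u - v)] with [(u, v)] counted on
    the right at [n / 2]; [l] being odd lets the congruences be halved. *)
Lemma theta_mul_even s t :
  lproj 2 0 (theta l (s + t) * theta l (s - t)) = (theta l s * theta l t) ^+ 2.
Proof.
apply: laurentP => n; rewrite sqr_coef ?F2_pchar// F2_exp.
transitivity (if (2 %| n)%Z then (theta l (s + t) * theta l (s - t)) n else 0).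
  by rewrite -[n in (2 %| n)%Z]subr0 -eqz_mod_dvd.
rewrite !theta_mul_coef; case: ifP => // n2.
apply: (reindex_fsbig (fun p => (p.1 + p.2, p.1 - p.2))); split.
- move=> [u v] [/= us vt uv]; split=> /=; first exact: eq_modD.
    by apply: eq_modD => //; exact: eq_modN.
  have -> : (u + v) ^+ 2 + (u - v) ^+ 2 = (u ^+ 2 + v ^+ 2) * 2 by ring.
  by rewrite uv; move: n2; clear; lia.
- by move=> [u v] [u' v'] _ _ /= [uE vE]; congr (_, _); move: uE vE; clear; lia.
move=> [k m] [/= ks mt km].
pose u := ((k + m) %/ 2)%Z; pose v := k - u.
(* The division is exact: [k + m] has the parity of [k ^+ 2 + m ^+ 2 = n], which is even. *)
have um : k + m = u *+ 2.
  have [w kw] := sqr_mod2 k; have [w' mw] := sqr_mod2 m.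
  by rewrite /u; move: kw mw km n2; clear; lia.
have mE : m = u - v by rewrite /v; move: um; clear; lia.
have kE : k = u + v by rewrite /v; clear; lia.
exists (u, v); last by rewrite -kE -mE.
split=> /=.
- apply: eq_mod_double; rewrite -um (eq_modD ks mt).
  by congr (_ %% _)%Z; clear; lia.
- apply: eq_mod_double; have -> : v *+ 2 = k - m by rewrite /v; move: um; clear; lia.
  by rewrite (eq_modD ks (eq_modN mt)); congr (_ %% _)%Z; lia.
have : k ^+ 2 + m ^+ 2 = (u ^+ 2 + v ^+ 2) * 2 by rewrite kE mE; ring.
by rewrite km; move: n2; clear; lia.
Qed.

End Theta.

(** * Projections of [1 / a] deduced from the theta relations *)

Lemma F2_sqrD (f g : laurent 'F_2) : (f + g) ^+ 2 = f ^+ 2 + g ^+ 2.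
Proof. by rewrite exprDn_pchar ?pnatE//; exact: (pchar_laurent F2_pchar). Qed.

Lemma F2_expr4D (f g : laurent 'F_2) : (f + g) ^+ 4 = f ^+ 4 + g ^+ 4.
Proof. by rewrite !(exprM _ 2 2 : _ ^+ 4 = _) !F2_sqrD. Qed.

Lemma lproj_graded_mul3 (f g h : laurent 'F_2) (i j k m : int) :
  graded 8 i f -> graded 8 j g -> graded 8 k h ->
  lproj 8 m (f * g * h) = (f * g * h) *+ (i + j + k == m %[mod 8])%Z.
Proof. by move=> fi gj hk; rewrite mulrb; apply: lproj_graded; do 2?apply: graded_mul. Qed.

Section ThetaRelations.
Variables a b c A B : laurent 'F_2.
Hypothesis aE : a = b ^+ 4 + A.
Hypothesis bE : b = c ^+ 4 + B.
Hypothesis A1 : graded 8 1 A.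
Hypothesis B1 : graded 8 1 B.
Hypothesis ab_even : lproj 2 0 (a * b) = (a * c) ^+ 2.

(** In [(b ^+ 4 + A) * (c ^+ 4 + B)] both cross products live in odd degrees. *)
Lemma even_part_mul : b ^+ 4 * c ^+ 4 + A * B = (a * c) ^+ 2.
Proof.
have A2 : graded 2 1 A by exact: graded_dvd A1.
have B2 : graded 2 1 B by exact: graded_dvd B1.
have gr2 (f : laurent 'F_2) : graded 2 0 (f ^+ 4).
  by apply: (@graded_dvd _ _ 4) => //; exact: (graded_expr4 F2_pchar).
rewrite -ab_even.
have -> : a * b = (b ^+ 4 + A) * (c ^+ 4 + B) by rewrite -aE -bE.
rewrite mulrDl !mulrDr !lprojD.
rewrite (lproj_graded _ (graded_mul (gr2 b) (gr2 c))).
rewrite (lproj_graded _ (graded_mul (gr2 b) B2)).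
rewrite (lproj_graded _ (graded_mul A2 (gr2 c))).
rewrite (lproj_graded _ (graded_mul A2 B2)).
by rewrite addr0 add0r.
Qed.

Lemma lproj_expr7 :
  lproj 8 0 (a ^+ 7) = b ^+ 8 * c ^+ 8 * a ^+ 8 /\
  lproj 8 2 (a ^+ 7) = (a ^+ 2 + b ^+ 8) * c ^+ 8 * a ^+ 8.
Proof.
have gr8 (f : laurent 'F_2) : graded 8 0 (f ^+ 8) by apply: (graded_expr8 F2_pchar).
have gr16 (f : laurent 'F_2) : graded 8 0 (f ^+ 16) by rewrite (exprM f 2 8 : _ ^+ 16 = _).
have B4 : graded 8 4 (B ^+ 4) := @graded_exp _ _ _ _ 4 B1.
have A2 : graded 8 2 (A ^+ 2) := @graded_exp _ _ _ _ 2 A1.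
have A4 : graded 8 4 (A ^+ 4) := @graded_exp _ _ _ _ 4 A1.
have aC : a = c ^+ 16 + B ^+ 4 + A by rewrite {1}aE bE F2_expr4D -exprM.
have a2 : a ^+ 2 = b ^+ 8 + A ^+ 2 by rewrite {1}aE F2_sqrD -exprM.
have a4 : a ^+ 4 = b ^+ 16 + A ^+ 4 by rewrite {1}aE F2_expr4D -exprM.
have a7 : a ^+ 7 = (c ^+ 16 + B ^+ 4 + A) * (b ^+ 8 + A ^+ 2) * (b ^+ 16 + A ^+ 4).
  by rewrite -aC -a2 -a4 -exprS -exprD.
have cC := gr16 c; have b8 := gr8 b; have b16 := gr16 b.
(* Fourth power of the even-part relation, with both sides split by Frobenius. *)
have acE : c ^+ 8 * a ^+ 8 = (b ^+ 4 * c ^+ 4) ^+ 4 + (A * B) ^+ 4.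
  by rewrite -F2_expr4D even_part_mul -exprM exprMn mulrC.
have -> : a ^+ 2 + b ^+ 8 = A ^+ 2.
  by rewrite a2 addrAC -mulr2n (mulrn_pchar (pchar_laurent F2_pchar)) add0r.
rewrite -(mulrA (b ^+ 8)) -(mulrA (A ^+ 2)) acE a7 !(mulrDl, mulrDr) !lprojD.
(* Of the twelve products, [c^16 b^8 b^16] and [B^4 b^8 A^4] have residue 0 mod 8, while
   [c^16 A^2 b^16] and [B^4 A^2 A^4] have residue 2. *)
rewrite !(lproj_graded_mul3 _ cC b8 b16, lproj_graded_mul3 _ cC b8 A4,
          lproj_graded_mul3 _ cC A2 b16, lproj_graded_mul3 _ cC A2 A4,
          lproj_graded_mul3 _ B4 b8 b16, lproj_graded_mul3 _ B4 b8 A4,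
          lproj_graded_mul3 _ B4 A2 b16, lproj_graded_mul3 _ B4 A2 A4,
          lproj_graded_mul3 _ A1 b8 b16, lproj_graded_mul3 _ A1 b8 A4,
          lproj_graded_mul3 _ A1 A2 b16, lproj_graded_mul3 _ A1 A2 A4).
by split; rewrite !(mulr0n, mulr1n) !(addr0, add0r); ring.
Qed.

(** Since [1 / a * a ^+ 8 = a ^+ 7], the projections of [a ^+ 7] suffice, and [a ^+ 8] can be
    cancelled. *)
Lemma lproj_inv_of_odd_parts : a != 0 ->
  lproj 8 0 (1 / a) = b ^+ 8 * c ^+ 8 /\
  lproj 8 2 (1 / a) = (a ^+ 2 + b ^+ 8) * c ^+ 8.
Proof.
move=> a0; have [p0 p2] := lproj_expr7.
have a8 : a ^+ 8 != 0 by rewrite expf_neq0.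
have projE j : lproj 8 j (1 / a) * a ^+ 8 = lproj 8 j (a ^+ 7).
  rewrite -lproj_mulr; last exact: (graded_expr8 F2_pchar).
  by congr (lproj _ _ _); rewrite mul1r exprS mulKf.
by split; apply: (mulIf a8); rewrite projE.
Qed.

End ThetaRelations.

Theorem theorem5p1 (r : int) (hr : r \in [:: 1; 2; 3]) :
  let l := 7%N in
  let a := theta l r in
  let b := theta l (4 * r) in
  let c := theta l (2 * r) in
  lproj 8 0 (1 / a) = b ^+ 8 * c ^+ 8 /\
  lproj 8 2 (1 / a) = (a ^+ 2 + b ^+ 8) * c ^+ 8.
Proof.
move=> l a b c.
apply: (@lproj_inv_of_odd_parts a b c (a - b ^+ 4) (b - c ^+ 4)).
- by rewrite subrKC.
- by rewrite subrKC.
(* Twice [4 * r] is [8 * r], congruent to [r] mod 7; in the next case twice [2 * r] is [4 * r]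
   itself. *)
- by apply: theta_odd_part => //; lia.
- by apply: theta_odd_part => //; lia.
(* With [s = - r] and [t = 2 * r], [s + t = r] and [s - t = - 3 * r] is congruent to [4 * r] mod 7,
   so the product on the left is [a * b]; evenness of theta in its index turns [theta l (- r)] into
   [a]. *)
- have := @theta_mul_even l isT (- r) (2 * r).
  rewrite thetaN (_ : - r + 2 * r = r); last by ring.
  by rewrite (@eq_theta l (- r - 2 * r) (4 * r)); last lia.
by apply: theta_neq0; move: hr; rewrite !inE; lia.
Qed.
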